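(* Let $\{Y(t)\}_{t\ge0}$ be a Lévy process whose Laplace exponent is $\psi(\eta)=\sum_{k=1}^{\infty}d_k\eta^k$. Let $m$ be the smallest index $k$ with $d_k\neq 0$ and let $\xi=d_m$ be the first non-zero coefficient. Let $\{S_\alpha^{(\epsilon)}(t)\}_{t\ge0}$ be the InG-$\epsilon$ subordinator with parameters $\alpha$ and $\epsilon>0$, independent of $\{Y(t)\}_{t\ge0}$, and put $Q_\alpha^{(\epsilon)}(t):=Y(S_\alpha^{(\epsilon)}(t))$. Then, for $p\in(0,1)$, the fractional moment of order $p$ of $\{Q_\alpha^{(\epsilon)}(t)\}_{t\ge0}$ exists, is finite for $p<\alpha$, and its asymptotic behaviour is given by $$\mathbb{E}[Q_\alpha^{(\epsilon)}(t)]^p\sim \frac{\alpha\, c_0\, t^{\frac{p}{m\alpha}}\,\Gamma\left(1-\frac{p}{m\alpha}\right)}{\Gamma(1-p)}\qquad\text{as } t\to\infty,$$ where $c_0=\dfrac{\xi^{p/m}}{\alpha}$.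
   Context: The Laplace exponent $\psi$ of a Lévy process $\{Y(t)\}_{t\ge0}$ is defined by $\mathbb{E}[e^{-\eta Y(t)}]=e^{-t\psi(\eta)}$, $\eta>0$. The lower incomplete gamma function is $\gamma(\alpha;\eta)=\int_0^\eta e^{-y}y^{\alpha-1}\,dy$. The InG-$\epsilon$ subordinator $\{S^{(\epsilon)}_\alpha(t)\}_{t\ge0}$, $0<\alpha\le1$, $\epsilon>0$, is the non-decreasing Lévy process with $\mathbb{E}[e^{-\eta S^{(\epsilon)}_\alpha(t)}]=\exp\left(-t\,\frac{\alpha}{\epsilon^{\alpha}}\gamma(\alpha;\eta\epsilon)\right)$, $\eta>0$. The notation $\mathbb{E}[Q]^p$ means $\mathbb{E}[Q^p]$, the $p$-th order moment, and $g\sim h$ means that the ratio $g/h$ tends to $1$ in the indicated limit.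
   Formalization: Assumes Q(t) ≥ 0 almost surely for each t ≥ 0, without which the real power Q(t)^p is undefined (e.g. Y Brownian); this forces ξ > 0 and in effect m = 1. The asymptotics are stated for p < α, and path regularity is required for every outcome. *)

(* Defs.v *)
From HB Require Import structures.
From mathcomp Require Import all_boot all_order all_algebra.
From mathcomp Require Import all_classical all_reals all_analysis.

Set Implicit Arguments.
Unset Strict Implicit.
Unset Printing Implicit Defensive.

Import Order.TTheory GRing.Theory Num.Theory.
Import numFieldNormedType.Exports.

Local Open Scope classical_set_scope.
Local Open Scope ring_scope.

(* Meaningful for z > 0 only: otherwise the integral diverges and its real
   value is junk. *)
Definition Gamma {R : realType} (z : R) : R :=
  \int[lebesgue_measure]_(y in `]0, +oo[) (expR (- y) * y `^ (z - 1)).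

Definition lower_gamma {R : realType} (a x : R) : R :=
  \int[lebesgue_measure]_(y in `]0, x[) (expR (- y) * y `^ (a - 1)).

(* Processes are indexed by the whole of R, but every notion below looks at
   times t >= 0 only. *)
Section processes.
Context {d : measure_display} {T : measurableType d} {R : realType}.
Variable P : probability T R.
Implicit Types (X Y S : R -> {RV P >-> R}) (D : set R).

Definition sigma_process D X : set_system T :=
  <<s [set A | exists t B, [/\ D t, measurable B & A = X t @^-1` B]] >>.

Definition indep_sigma (F G : set_system T) : Prop :=
  forall A B, F A -> G B -> P (A `&` B) = (P A * P B)%E.

Definition indep_processes X Y : Prop :=
  indep_sigma (sigma_process `[0, +oo[ X) (sigma_process `[0, +oo[ Y).

(* The regularity of paths is required for every outcome, rather than almost
   every outcome, so that the subordinated process below is a random variable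
   on T itself and not merely on the completion of P. *)
Definition cadlag (f : R -> R) : Prop :=
  (forall t : R, 0 <= t -> f x @[x --> t^'+] --> f t) /\
  (forall t : R, 0 < t -> exists l : R, f x @[x --> t^'-] --> l).

Definition increment X (s t : R) (w : T) : R := X t w - X s w.

Record levy_process X : Prop := LevyProcess {
  levy_start : {ae P, forall w, X 0 w = 0} ;
  levy_cadlag : forall w, cadlag (X ^~ w) ;
  levy_indep_increments : forall s t : R, 0 <= s -> s <= t ->
    forall A B, sigma_process `[0, s] X A -> measurable B ->
      P (A `&` (increment X s t @^-1` B)) =
      (P A * P (increment X s t @^-1` B))%E ;
  levy_stationary_increments : forall s t : R, 0 <= s -> s <= t ->
    forall B, measurable B ->
      P (increment X s t @^-1` B) = P (X (t - s) @^-1` B) }.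

Definition laplace_exponent X (psi : R -> R) : Prop :=
  forall t eta : R, 0 <= t -> 0 < eta ->
    'E_P[fun w => expR (- (eta * X t w))%R]%E = (expR (- (t * psi eta)))%:E.

(* Non-negativity is part of being a subordinator; it does not follow from
   monotonicity, as a Levy process starts at 0 only almost surely. *)
Record subordinator S : Prop := Subordinator {
  subordinator_levy : levy_process S ;
  subordinator_ge0 : forall (t : R) w, 0 <= t -> 0 <= S t w ;
  subordinator_nondecreasing : forall (s t : R) w,
    0 <= s -> s <= t -> S s w <= S t w }.

Definition InG_subordinator (alpha eps : R) S : Prop :=
  subordinator S /\
  laplace_exponent S
    (fun eta => alpha / eps `^ alpha * lower_gamma alpha (eta * eps)).

Definition subordinated Y S (t : R) (w : T) : R := Y (S t w) w.

End processes.

Definition asymp_equiv {R : realType} (g h : R -> R) : Prop :=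
  g t / h t @[t --> +oo] --> (1 : R).

(* Main.v *)
Require Import Defs.
From HB Require Import structures.
From mathcomp Require Import all_boot all_order all_algebra.
From mathcomp Require Import all_classical all_reals all_analysis.
From mathcomp Require Import measurable_realfun ring lra.

Set Implicit Arguments.
Unset Strict Implicit.
Unset Printing Implicit Defensive.

Import Order.TTheory GRing.Theory Num.Theory.
Import numFieldNormedType.Exports.

Local Open Scope classical_set_scope.
Local Open Scope ring_scope.

(* For [0 < p < 1] and [x >= 0],
     [int_0^oo u^(-p-1) (1 - e^(-u x)) du = x^p Gamma(1-p) / p],
   so by Tonelli a fractional moment of [Q(t)] is an integral of its Laplace
   transform [exp (- t F(u))], where [F = phi o psi] and [phi] is the Laplace
   exponent of the InG subordinator.  The bounds
   [e^(-eps x) x^alpha <= phi(x) <= x^alpha] and [psi(u) ~ xi u^m] give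
   [F(u) ~ xi^alpha u^(m alpha)] at [0+].  After normalising [Q(t)] by
   [t^(1/(m alpha))], dominated convergence replaces [t F(t^(-1/(m alpha)) u)]
   by [xi^alpha u^(m alpha)] under the integral, and the limit integral is
   again a Gamma value. *)

(** A process is given as one random variable per time, with no joint measurability in time and
    outcome, so conditioning on the independent time [S t] is not a bare use of Fubini: right
    continuity of the paths of [Y] supplies the missing link through countably valued times. The
    exponent of [S] is prescribed at positive arguments only, so forming [phi (psi u)] requires
    [psi u >= 0], and the limit constant requires [xi > 0]. Both are extracted from the almost sure
    non-negativity of the subordinated process. The rescaling acts on the random variable and not on
    the integration variable: with [l = t^(-1/(m alpha))], the variable [l Q(t)] has exponent
    [t F(l u)], and [t l^(m alpha) = 1]. This [F] is controlled near [0] only; for large [u] the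
    domination rests on [1 - exp (- x) <= 1] alone. The condition [p < m alpha], which follows from
    [p < alpha], makes [u^(m alpha - p - 1)] integrable at [0]. *)

Section power_integrals.
Context {R : realType}.
Notation mu := (@lebesgue_measure R).
Implicit Types a b c p u v x y z : R.

(** * Integrals of powers and exponentials, and the Gamma integral on (0, 1) *)

Lemma is_derive_cvg (f : R -> R) x (df : R) :
  is_derive x 1 f df -> f y @[y --> x] --> f x.
Proof.
by move=> fx; apply/differentiable_continuous/derivable1_diffP; case: fx.
Qed.

Lemma is_derive_powR a x : 0 < x ->
  is_derive x 1 (fun y => y `^ a) (a * x `^ (a - 1)).
Proof.
move=> x0; have xI : x \in `]0, +oo[ by rewrite in_itv/= x0.
apply: DeriveDef; first exact: derivable_powR.
by rewrite -derive1E powR_derive1.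
Qed.

Lemma continuous_powR a x : 0 < x -> y `^ a @[y --> x] --> x `^ a.
Proof. by move=> x0; exact: is_derive_cvg (is_derive_powR a x0). Qed.

Lemma cvg_powR_pinfty a : 0 < a -> x `^ (- a) @[x --> +oo] --> (0 : R).
Proof.
move=> a0; apply/cvgrPdist_lt => e e0; near=> x.
have x0 : 0 < x by near: x; exact: nbhs_pinfty_gt.
rewrite sub0r normrN ger0_norm ?powR_ge0// powRN.
rewrite invf_plt ?posrE ?powR_gt0//.
have -> : e^-1 = (e^-1 `^ a^-1) `^ a.
  by rewrite -powRrM mulVf ?gt_eqF// powRr1// invr_ge0 ltW.
by apply: gt0_ltr_powR => //; rewrite ?nnegrE ?powR_ge0 ?(ltW x0).
Unshelve. all: by end_near. Qed.

Lemma integral_powR_tail a p : 0 < a -> 0 < p ->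
  (\int[mu]_(u in `]a, +oo[) (u `^ (- p - 1))%:E = (p^-1 * a `^ (- p))%:E)%E.
Proof.
move=> a0 p0.
have mf D : measurable D -> measurable_fun D (fun u : R => (u `^ (- p - 1))%:E).
  move=> mD; apply/measurable_EFinP.
  by apply: (measurable_funS measurableT) => //; exact: measurable_powR.
rewrite integral_itv_obnd_cbnd; last exact: mf.
have dF (x : R) : a <= x ->
    is_derive x 1 (fun u => - p^-1 * u `^ (- p)) (x `^ (- p - 1)).
  move=> ax; have x0 := lt_le_trans a0 ax.
  have := @is_deriveM _ _ (cst (- p^-1)) _ x 1 _ _
    (is_derive_cst _ _ _) (is_derive_powR (- p) x0).
  move=> /is_derive_eq; apply.
  rewrite /= /GRing.scale/= mulr0 addr0 mulrA mulrNN mulVf ?mul1r//.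
  by rewrite gt_eqF.
rewrite (@ge0_continuous_FTC2y _ _ (fun u => - p^-1 * u `^ (- p)) a 0).
- by rewrite -EFinB sub0r mulNr opprK.
- by move=> x _; exact: powR_ge0.
- apply/continuous_within_itvcyP; split=> [x|].
    by rewrite in_itv/= andbT => ax; apply: continuous_powR; exact: lt_trans ax.
  by apply: cvg_at_right_filter; exact: continuous_powR.
- rewrite -[X in _ --> X](mulr0 (- p^-1)); apply: cvgMl_tmp => //.
  exact: cvg_powR_pinfty.
- by move=> x ax; case: (dF x (ltW ax)).
- by apply: cvg_at_right_filter; exact: is_derive_cvg (dF a (lexx _)).
- move=> x; rewrite in_itv/= andbT => ax.
  by rewrite derive1E; apply: derive_val; exact: dF (ltW ax).
Qed.

Lemma integral_expRN v : 0 <= v ->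
  (\int[mu]_(y in `]0%R, v[) (expR (- y))%:E = (1 - expR (- v))%:E)%E.
Proof.
rewrite le_eqVlt => /predU1P[<-|v0].
  by rewrite set_itvoo0 integral_set0 oppr0 expR0 subrr.
have mf (D : set R) :
    measurable D -> measurable_fun D (fun y => (expR (- y))%:E).
  move=> mD; apply/measurable_EFinP; apply: measurable_funTS.
  exact: measurableT_comp.
rewrite integral_itv_bndo_bndc ?integral_itv_obnd_cbnd; [|exact: mf..].
have dF (x : R) : is_derive x 1 (fun u => - expR (- u)) (expR (- x)).
  have := @is_deriveN _ _ _ _ _ _ _ (@is_derive1_comp _ _ _ x _ _
    (is_derive_expR _)
    (@is_deriveN _ _ _ _ _ _ _ (is_derive_id x 1))).
  by move=> /is_derive_eq; apply; rewrite mulrN1 opprK.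
have cF : continuous (fun u : R => - expR (- u)).
  by move=> x; exact: is_derive_cvg (dF x).
rewrite (@continuous_FTC2 _ _ (fun u => - expR (- u)) 0 v) //.
- by rewrite -EFinB oppr0 expR0; congr EFin; rewrite opprK addrC.
- apply: continuous_subspaceT => x; apply: continuous_comp.
    exact: opp_continuous.
  exact: continuous_expR.
- by split=> [x _||]; [case: (dF x)|apply: cvg_at_right_filter; exact: cF
    |apply: cvg_at_left_filter; exact: cF].
- by move=> x _; rewrite derive1E; exact: derive_val.
Qed.

(** For [a < 1] the integrand blows up at [0], so the fundamental theorem of calculus is applied on
    [[1/(n+1), b]] and monotone convergence along these growing intervals gives the rest. *)
Lemma integral_powR_head b a : 0 < b -> 0 < a ->
  (\int[mu]_(y in `]0%R, b[) (y `^ (a - 1))%:E = (a^-1 * b `^ a)%:E)%E.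
Proof.
move=> b0 a0.
have mf D : measurable D -> measurable_fun D (fun u : R => (u `^ (a - 1))%:E).
  move=> mD; apply/measurable_EFinP.
  by apply: (measurable_funS measurableT) => //; exact: measurable_powR.
have dF (x : R) :
    0 < x -> is_derive x 1 (fun u => a^-1 * u `^ a) (x `^ (a - 1)).
  move=> x0.
  have := @is_deriveM _ _ (cst a^-1) _ x 1 _ _
    (is_derive_cst _ _ _) (is_derive_powR a x0).
  move=> /is_derive_eq; apply.
  by rewrite /= /GRing.scale/= mulr0 addr0 mulrA mulVf ?mul1r// gt_eqF.
have cF (x : R) : 0 < x -> a^-1 * u `^ a @[u --> x] --> a^-1 * x `^ a.
  by move=> x0; exact: is_derive_cvg (dF x x0).
rewrite integral_itv_bndo_bndc; last exact: mf.
pose F (n : nat) : set R := `[n.+1%:R^-1, b]%classic.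
have F0 n : 0 < n.+1%:R^-1 :> R by rewrite invr_gt0.
have FE : `]0, b]%classic = \bigcup_n F n.
  apply/seteqP; split => [x|x [n _]]; rewrite /F/= !in_itv/=.
    move=> /andP[x0 xb]; exists (Num.truncn x^-1) => //=.
    rewrite in_itv/= xb andbT.
    rewrite invf_ple ?posrE//; apply/ltW.
    have x1 : 0 <= x^-1 by rewrite invr_ge0 ltW.
    by have /andP[] := truncn_itv x1.
  by move=> /andP[nx ->]; rewrite (lt_le_trans (F0 n) nx).
have h : (\int[mu]_(y in F n) (y `^ (a - 1))%:E)%E @[n --> \oo] -->
    (\int[mu]_(y in `]0%R, b]) (y `^ (a - 1))%:E)%E.
  rewrite FE; apply: ge0_nondecreasing_set_cvg_integral.
  - move=> m n mn; apply/subsetPset => x; rewrite /F/= !in_itv/=.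
    move=> /andP[mx ->].
    rewrite andbT (le_trans _ mx)// lef_pV2 ?posrE// ler_nat ltnS//.
  - by move=> n; exact: measurable_itv.
  - by move=> n; apply: mf; exact: measurable_itv.
  - by move=> n x _; rewrite lee_fin powR_ge0.
apply: (cvg_unique _ h) => //.
have g : (a^-1 * b `^ a - a^-1 * n.+1%:R^-1 `^ a)%:E @[n --> \oo] -->
    (a^-1 * b `^ a)%:E.
  apply: cvg_EFin; first by apply: nearW.
  rewrite -[X in _ --> X]subr0; apply: cvgB; first exact: cvg_cst.
  rewrite -[X in _ --> X](mulr0 a^-1); apply: cvgMl_tmp.
  have /cvg_at_rightP := powR_cvg0 a0.
  by apply; split => //; exact: cvg_harmonic.
apply: cvg_trans g; apply: near_eq_cvg.
near=> n.
have nb : n.+1%:R^-1 < b.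
  by near: n; exact: (near_infty_natSinv_lt (PosNum b0)).
rewrite (@continuous_FTC2 _ _ (fun u => a^-1 * u `^ a) _ _ nb) //.
- apply: derivable_within_continuous => x; rewrite in_itv/= => /andP[nx _].
  have x0 := lt_le_trans (F0 n) nx.
  by case: (is_derive_powR (a - 1) x0).
- split=> [x /[!in_itv]/= /andP[nx _]||].
  + by case: (dF x (lt_trans (F0 n) nx)).
  + by apply: cvg_at_right_filter; exact: cF.
  + by apply: cvg_at_left_filter; exact: cF.
- move=> x /[!in_itv]/= /andP[nx _]; rewrite derive1E; apply: derive_val.
  exact: dF (lt_trans (F0 n) nx).
Unshelve. all: by end_near. Qed.

(** Writing [1 - exp (- c u^b)] as the integral of [exp (- y)] over [0 < y < c u^b] and exchanging
    the order, [u] runs over the tail beyond [(y / c)^(1/b)], where the power integrates explicitly.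
    The case [b = 1] yields the kernel of the fractional moment, and [b = m alpha] the limit
    integral. *)
Lemma integral_powR_expR p b c : 0 < p -> 0 < b -> 0 < c ->
  (\int[mu]_(u in `]0%R, +oo[) (u `^ (- p - 1) * (1 - expR (- (c * u `^ b))))%:E
   = (p^-1 * c `^ (p / b))%:E *
     \int[mu]_(y in `]0%R, +oo[) (expR (- y) * y `^ (1 - p / b - 1))%:E)%E.
Proof.
move=> p0 b0 c0.
pose f (z : R * R) : \bar R := (if [&& 0 < z.1, 0 < z.2 & z.2 < c * z.1 `^ b]
  then z.1 `^ (- p - 1) * expR (- z.2) else 0)%:E.
have mf : measurable_fun setT f.
  apply/measurable_EFinP; apply: measurable_fun_ifT => //.
  - apply: measurable_and; first exact: measurable_fun_ltr.
    apply: measurable_and; first exact: measurable_fun_ltr.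
    apply: measurable_fun_ltr => //; apply: measurable_funM => //.
    exact: (measurableT_comp (measurable_powR b)).
  - apply: measurable_funM.
      by apply: (measurableT_comp (measurable_powR (- p - 1))).
    by apply: measurableT_comp => //; exact: measurableT_comp.
have f0 (z : R * R) : (0 <= f z)%E.
  by rewrite lee_fin; case: ifP => // _; rewrite mulr_ge0 ?powR_ge0 ?expR_ge0.
have := fubini_tonelli (m1 := mu) (m2 := mu) f mf f0.
have -> : (\int[mu]_x \int[mu]_y f (x, y) = \int[mu]_(u in `]0%R, +oo[)
    (u `^ (- p - 1) * (1 - expR (- (c * u `^ b))))%:E)%E.
  rewrite [RHS]integral_mkcond; apply: eq_integral => u _.
  rewrite patchE; case: ifPn => [|]; rewrite mem_setE in_itv/= andbT => u0;
    last first.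
    by rewrite integral0_eq// => y _; rewrite /f/= (negbTE u0).
  rewrite EFinM -integral_expRN ?mulr_ge0 ?powR_ge0 ?(ltW c0)//.
  rewrite -ge0_integralZl_EFin ?powR_ge0//; last first.
    apply/measurable_EFinP; apply: measurable_funTS.
    exact: measurableT_comp.
  rewrite [RHS]integral_mkcond; apply: eq_integral => y _.
  rewrite patchE /f/= u0/=.
  by case: ifPn => yI; case: ifPn => //;
    rewrite mem_setE in_itv/= ?yI// (negbTE yI).
move=> ->; rewrite -ge0_integralZl_EFin; last 4 first.
- exact: measurable_itv.
- by move=> y _; rewrite lee_fin mulr_ge0 ?expR_ge0 ?powR_ge0.
- apply/measurable_EFinP; apply: measurable_funTS; apply: measurable_funM.
    exact: measurableT_comp.
  exact: measurable_powR.
- by rewrite mulr_ge0 ?invr_ge0 ?powR_ge0 ?(ltW p0).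
rewrite [RHS]integral_mkcond; apply: eq_integral => y _.
rewrite patchE; case: ifPn => [|]; rewrite mem_setE in_itv/= andbT => y0;
  last first.
  by rewrite integral0_eq// => u _; rewrite /f/= (negbTE y0) andbF.
have yc0 : 0 < (y / c) `^ b^-1 by rewrite powR_gt0 ?divr_gt0.
transitivity ((expR (- y))%:E * \int[mu]_(u in `]((y / c) `^ b^-1)%R, +oo[)
   (u `^ (- p - 1))%:E)%E.
  rewrite -ge0_integralZl_EFin ?expR_ge0//; last first.
  - by apply/measurable_EFinP; apply: measurable_funTS; exact: measurable_powR.
  - by move=> u _; rewrite lee_fin powR_ge0.
  rewrite [RHS]integral_mkcond; apply: eq_integral => u _.
  rewrite patchE /f/= y0/=.
  have [u0|u0] := ltP 0 u; last first.
    case: ifPn => //; rewrite mem_setE in_itv/= andbT => /(lt_trans yc0).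
    by rewrite ltNge u0.
  have -> : (y < c * u `^ b) = (u \in `](y / c) `^ b^-1, +oo[%classic).
    apply/idP/idP; rewrite mem_setE in_itv/= andbT.
      rewrite mulrC -ltr_pdivrMr// => h.
      have -> : u = (u `^ b) `^ b^-1.
        by rewrite -powRrM mulfV ?gt_eqF// powRr1// ltW.
      apply: gt0_ltr_powR => //; rewrite ?invr_gt0// ?nnegrE ?powR_ge0//.
      by rewrite divr_ge0// ltW.
    move=> h; rewrite mulrC -ltr_pdivrMr//.
    have -> : y / c = ((y / c) `^ b^-1) `^ b.
      by rewrite -powRrM mulVf ?gt_eqF// powRr1// divr_ge0// ltW.
    by apply: gt0_ltr_powR => //; rewrite nnegrE ltW.
  by rewrite andTb; case: ifPn => // _; rewrite EFinM muleC.
rewrite integral_powR_tail// -EFinM; congr EFin.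
rewrite -powRrM powRM ?invr_ge0 ?(ltW y0) ?(ltW c0)//.
rewrite -(powR_inv1 (ltW c0)) -[in X in X = _]powRrM.
have -> : b^-1 * - p = - (p / b) by rewrite mulrN mulrC.
have -> : 1 - p / b - 1 = - (p / b) by rewrite addrAC subrr sub0r.
by rewrite mulrNN mul1r; ring.
Qed.

Let measurable_Gamma_fun z (D : set R) :
  measurable_fun D (fun y => (expR (- y) * y `^ (z - 1))%:E).
Proof.
apply: measurable_funTS; apply/measurable_EFinP; apply: measurable_funM.
  exact: measurableT_comp.
exact: measurable_powR.
Qed.

(** The integrand is at most [y^(z-1)] on (0, 1) and, since [e^y >= y], at most [y^(z-2)] beyond
    [1]; the two bounds are integrable because [z > 0] and [z < 1] respectively. Every Gamma
    argument met below lies in this range. *)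
Lemma Gamma_lty z : 0 < z < 1 ->
  (\int[mu]_(y in `]0%R, +oo[) (expR (- y) * y `^ (z - 1))%:E < +oo)%E.
Proof.
move=> /andP[z0 z1].
have -> : `]0, +oo[%classic = `]0, 1[%classic `|` `[1, +oo[%classic :> set R.
  by rewrite -itv_bndbnd_setU// bnd_simp.
rewrite ge0_integral_setU//=; last 2 first.
- by move=> y _; rewrite lee_fin mulr_ge0 ?expR_ge0 ?powR_ge0.
- apply/disj_setPS => y [] /=; rewrite !in_itv/= andbT => /andP[_ y1].
  by rewrite leNgt y1.
apply: lte_add_pinfty.
- apply: (@le_lt_trans _ _ (\int[mu]_(y in `]0%R, 1%R[) (y `^ (z - 1))%:E)%E).
    apply: ge0_le_integral => //.
    + by move=> y _; rewrite lee_fin mulr_ge0 ?expR_ge0 ?powR_ge0.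
    + exact: measurable_Gamma_fun.
    + apply/measurable_EFinP; apply: measurable_funTS; exact: measurable_powR.
    + move=> y /=; rewrite in_itv/= => /andP[y0 _].
      by rewrite lee_fin ler_piMl ?powR_ge0// -expR0 ler_expR oppr_le0 ltW.
  by rewrite integral_powR_head// ltry.
- rewrite -integral_itv_obnd_cbnd//.
  apply: (@le_lt_trans _ _
      (\int[mu]_(y in `]1%R, +oo[) (y `^ (- (1 - z) - 1))%:E)%E).
    apply: ge0_le_integral => //.
    + by move=> y _; rewrite lee_fin mulr_ge0 ?expR_ge0 ?powR_ge0.
    + exact: measurable_Gamma_fun.
    + apply/measurable_EFinP; apply: measurable_funTS; exact: measurable_powR.
    + move=> y /=; rewrite in_itv/= andbT => y1.
      have y0 : 0 < y := lt_trans ltr01 y1.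
      rewrite lee_fin opprB [in leRHS]powRB ?(gt_eqF y0) ?implybT//.
      rewrite mulrC ler_wpM2l ?powR_ge0// powRr1 ?(ltW y0)// expRN.
      rewrite lef_pV2 ?posrE ?expR_gt0//.
      by rewrite (le_trans _ (expR_ge1Dx y))// lerDr.
  by rewrite integral_powR_tail ?subr_gt0// ltry.
- exact: measurable_Gamma_fun.
Qed.

Lemma GammaE z : 0 < z < 1 ->
  (\int[mu]_(y in `]0%R, +oo[) (expR (- y) * y `^ (z - 1))%:E = (Gamma z)%:E)%E.
Proof.
move=> z01; rewrite /Gamma /Rintegral fineK// ge0_fin_numE ?Gamma_lty//.
by apply: integral_ge0 => y _; rewrite lee_fin mulr_ge0 ?expR_ge0 ?powR_ge0.
Qed.

(** On (0, 1) the factor [y^(z-1)] is at least [1], which leaves [1 - e^(-1)] as a lower bound. *)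
Lemma Gamma_gt0 z : 0 < z < 1 -> 0 < Gamma z.
Proof.
move=> z01; rewrite -lte_fin -GammaE//.
apply: (@lt_le_trans _ _ (\int[mu]_(y in `]0%R, 1%R[) (expR (- y))%:E)%E).
  by rewrite integral_expRN// lte_fin subr_gt0 -[ltRHS]expR0 ltr_expR ltrN10.
apply: (@le_trans _ _
    (\int[mu]_(y in `]0%R, 1%R[) (expR (- y) * y `^ (z - 1))%:E)%E).
  apply: ge0_le_integral => //.
  - apply/measurable_EFinP; apply: measurable_funTS; exact: measurableT_comp.
  - exact: measurable_Gamma_fun.
  - move=> y /=; rewrite in_itv/= => /andP[y0 y1].
    rewrite lee_fin ler_peMr ?expR_ge0// -[leLHS](powRr0 y).
    case/andP: z01 => _ z1.
    by apply: ger_powR; rewrite ?y0 ?(ltW y1)// subr_le0 ltW.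
apply: ge0_subset_integral => //.
- exact: measurable_Gamma_fun.
- by move=> y _; rewrite lee_fin mulr_ge0 ?expR_ge0 ?powR_ge0.
- by apply: subset_itvl; rewrite bnd_simp.
Qed.
End power_integrals.

(** * Evaluating a right-continuous process at an independent random time *)

Section random_time.
Context {d : measure_display} {T : measurableType d} {R : realType}.
Variable P : probability T R.

(** Independence says that the law of [X] under [P] restricted to [A] is [P A] times its law under
    [P]; both sides are integrals of [f] against these laws. *)
Lemma integral_indep_event (A : set T) (X : {RV P >-> R}) (f : R -> R) :
  measurable A ->
  (forall B, measurable B -> P (A `&` X @^-1` B) = P A * P (X @^-1` B))%E ->
  measurable_fun setT f -> (forall x, 0 <= f x) ->
  (\int[P]_(w in A) (f (X w))%:E = P A * \int[P]_w (f (X w))%:E)%E.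
Proof.
move=> mA indep mf f0.
have mfX D : measurable_fun D (fun w => (f (X w))%:E).
  by apply: measurable_funTS; apply/measurable_EFinP; exact: measurableT_comp.
have PA0 : 0 <= fine (P A) by rewrite fine_ge0.
have PAE : P A = (fine (P A))%:E by rewrite fineK// fin_num_measure.
pose m1 : {measure set T -> \bar R} := mrestr P mA.
have -> : (\int[P]_(w in A) (f (X w))%:E = \int[m1]_(w in A) (f (X w))%:E)%E.
  apply: eq_measure_integral => B mB BA.
  by rewrite /m1 /= /mrestr setIidl.
have -> : (\int[m1]_(w in A) (f (X w))%:E = \int[m1]_w (f (X w))%:E)%E.
  rewrite [RHS](ge0_negligible_integral (measurableC mA))//.
  - by rewrite setTD setCK.
  - by move=> w _; rewrite lee_fin.
  - by rewrite /m1 /= /mrestr setICl measure0.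
rewrite PAE.
have -> : (\int[m1]_w (f (X w))%:E = \int[pushforward m1 X]_x (f x)%:E)%E.
  rewrite ge0_integral_pushforward//.
  - exact/measurable_EFinP.
  - by move=> x _; rewrite lee_fin.
have -> : (\int[P]_w (f (X w))%:E = \int[pushforward P X]_x (f x)%:E)%E.
  rewrite ge0_integral_pushforward//.
  - exact/measurable_EFinP.
  - by move=> x _; rewrite lee_fin.
rewrite -(ge0_integral_mscale _ _ (NngNum PA0))//.
- apply: eq_measure_integral => B mB _.
  by rewrite /= /mscale/= /pushforward/= /mrestr -PAE setIC indep.
- exact/measurable_EFinP.
- by move=> x _; rewrite lee_fin.
Qed.

Lemma measurable_fun_countable (g : nat -> T -> R) (N : T -> nat) :
  (forall n, measurable_fun setT (g n)) ->
  (forall n, measurable (N @^-1` [set n])) ->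
  measurable_fun setT (fun w => g (N w) w).
Proof.
move=> mg mN _ B mB; rewrite setTI.
have -> : (fun w => g (N w) w) @^-1` B =
    \bigcup_n (N @^-1` [set n] `&` g n @^-1` B).
  apply/seteqP; split => [w /= Bw|w [n _ [/= Nw]]]; first by exists (N w).
  by rewrite -Nw.
apply: bigcup_measurable => n _; apply: measurableI => //.
by rewrite -[X in measurable X]setTI; exact: mg.
Qed.


Variables (X : R -> {RV P >-> R}) (tau : {RV P >-> R}).
Hypothesis tau_ge0 : forall w, 0 <= tau w.
Hypothesis X_right_cont :
  forall w (s : R), 0 <= s -> X u w @[u --> s^'+] --> X s w.

(* The lattice-valued times [tau_ n] tend to [tau] strictly from above, so
   that right continuity of the paths is enough to pass to the limit. *)
Let N n w := (Num.truncn (n.+1%:R * tau w)).+1.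
Let tau_ n w : R := (N n w)%:R / n.+1%:R.

Let tau_gt n w : tau w < tau_ n w.
Proof.
rewrite /tau_ ltr_pdivlMr// mulrC.
by have /andP[] := truncn_itv (mulr_ge0 (ler0n R n.+1) (tau_ge0 w)).
Qed.

Let tau_cvg w : tau_ n w @[n --> \oo] --> tau w.
Proof.
apply: (@squeeze_cvgr _ _ _ _ (cst (tau w)) (fun n => tau w + n.+1%:R^-1)).
- near=> n; rewrite (ltW (tau_gt _ _))/=.
  rewrite /tau_ ler_pdivrMr// mulrDl mulVf// /N -natr1 lerD2r [leRHS]mulrC.
  by rewrite truncn_le mulr_ge0.
- exact: cvg_cst.
- rewrite -[X in _ --> X]addr0; apply: cvgD; first exact: cvg_cst.
  exact: cvg_harmonic.
Unshelve. all: by end_near. Qed.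

Let N_itv n k : N n @^-1` [set k.+1] =
  tau @^-1` `[k%:R / n.+1%:R, k.+1%:R / n.+1%:R[%classic.
Proof.
apply/seteqP; split => [w /= [<-]|w /=];
  rewrite in_itv/= ler_pdivrMr// ltr_pdivlMr//.
  by rewrite mulrC; apply: truncn_itv; rewrite mulr_ge0.
by rewrite mulrC => /truncn_def; rewrite /N => ->.
Qed.

Let N_0 n : N n @^-1` [set 0%N] = set0.
Proof. by apply/seteqP; split => w. Qed.

Let measurable_N n k : measurable (N n @^-1` [set k]).
Proof.
case: k => [|k]; first by rewrite N_0.
by rewrite N_itv -[X in measurable X]setTI; exact: measurable_funP.
Qed.

Let X_cvg w v : X (tau_ n w) v @[n --> \oo] --> X (tau w) v.
Proof.
have /cvg_at_rightP := @X_right_cont v _ (tau_ge0 w).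
by apply; split => [n|]; [exact: tau_gt|exact: tau_cvg].
Qed.

Lemma measurable_random_time : measurable_fun setT (fun w => X (tau w) w).
Proof.
apply: (@measurable_fun_cvg _ _ _ _ (fun n w => X (tau_ n w) w)) => [n|w _].
- exact: (measurable_fun_countable (g := fun k => X (k%:R / n.+1%:R))).
- exact: X_cvg.
Qed.

Hypothesis indep : forall (s : R) B C, 0 <= s -> measurable B -> measurable C ->
  (P (X s @^-1` B `&` tau @^-1` C) = P (X s @^-1` B) * P (tau @^-1` C))%E.

(** For lattice times, split over the value of [N n]: on each piece [X] is read at a fixed time
    while the piece itself is an event of [tau], so independence of each single [X s] from [tau] is
    enough. Continuity of [f] and the bound [M] then let dominated convergence pass to the limit,
    both in the outer integrals and inside the expectation [h]. *)
Lemma integral_random_time_bounded (f : R -> R) (M : R) :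
  continuous f -> (forall x, 0 <= f x <= M) ->
  measurable_fun setT (fun w => \int[P]_v (f (X (tau w) v))%:E)%E /\
  (\int[P]_w (f (X (tau w) w))%:E =
   \int[P]_w \int[P]_v (f (X (tau w) v))%:E)%E.
Proof.
move=> cf fM.
have mf : measurable_fun setT f by exact: continuous_measurable_fun.
have f0 x : 0 <= f x by case/andP: (fM x).
pose h s := fine (\int[P]_v (f (X s v))%:E)%E.
have mfX s : measurable_fun setT (fun v => (f (X s v))%:E).
  by apply/measurable_EFinP; exact: measurableT_comp.
have hE s : (\int[P]_v (f (X s v))%:E = (h s)%:E)%E.
  rewrite fineK// ge0_fin_numE; last first.
    by apply: integral_ge0 => v _; rewrite lee_fin.
  apply: (@le_lt_trans _ _ (\int[P]_v M%:E)%E).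
    apply: ge0_le_integral => //.
    - by move=> v _; rewrite lee_fin.
    - by move=> v _; rewrite lee_fin; case/andP: (fM (X s v)).
  by rewrite integral_cst//= probability_setT mule1 ltry.
have h0 s : 0 <= h s.
  by rewrite -lee_fin -hE; apply: integral_ge0 => v _; rewrite lee_fin.
have hM s : h s <= M.
  rewrite -lee_fin -hE -[leRHS]mule1 -(probability_setT P) -integral_cst//.
  apply: ge0_le_integral => //.
  - by move=> v _; rewrite lee_fin.
  - by move=> v _; rewrite lee_fin; case/andP: (fM (X s v)).
have intM : P.-integrable setT (cst M%:E).
  exact: finite_measure_integrable_cst.
have dct (g_ : nat -> T -> R) (g : T -> R) :
    (forall n, measurable_fun setT (g_ n)) ->
    (forall w, g_ n w @[n --> \oo] --> g w) ->
    (forall n w, 0 <= g_ n w <= M) ->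
    (\int[P]_w (g_ n w)%:E)%E @[n --> \oo] --> (\int[P]_w (g w)%:E)%E.
  move=> mg cg gM.
  have mg' : measurable_fun setT g.
    by apply: (measurable_fun_cvg mg) => w _; exact: cg.
  have [] // := @dominated_convergence _ _ _ P setT measurableT
    (fun n w => (g_ n w)%:E) (fun w => (g w)%:E) (cst M%:E).
  - by move=> n; apply/measurable_EFinP.
  - exact/measurable_EFinP.
  - by apply: aeW => w _; apply: cvg_EFin; [exact: nearW|exact: cg].
  - apply: aeW => w n _; rewrite /= lee_fin ger0_norm; by case/andP: (gM n w).
have fX_cvg w : f (X (tau_ n w) w) @[n --> \oo] --> f (X (tau w) w).
  by apply: continuous_cvg; [exact: cf|exact: X_cvg].
have h_cvg w : h (tau_ n w) @[n --> \oo] --> h (tau w).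
  have := dct (fun n v => f (X (tau_ n w) v)) (fun v => f (X (tau w) v)).
  under eq_cvg do rewrite hE.
  rewrite hE => /(_ _ _ _)/fine_cvg; apply.
  - by move=> n; exact: measurableT_comp.
  - by move=> v; apply: continuous_cvg; [exact: cf|exact: X_cvg].
  - by move=> n v; exact: fM.
have mh n : measurable_fun setT (fun w => h (tau_ n w)).
  exact: (measurable_fun_countable (g := fun k _ => h (k%:R / n.+1%:R))).
have mfX_ n : measurable_fun setT (fun w => f (X (tau_ n w) w)).
  apply: measurableT_comp => //.
  exact: (measurable_fun_countable (g := fun k => X (k%:R / n.+1%:R))).
split.
  under eq_fun do rewrite hE.
  apply/measurable_EFinP; apply: (measurable_fun_cvg mh) => w _.
  exact: h_cvg.
have lhs := dct _ _ mfX_ fX_cvg (fun n w => fM _).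
have rhs : (\int[P]_w (h (tau_ n w))%:E)%E @[n --> \oo] -->
    (\int[P]_w (h (tau w))%:E)%E.
  by apply: dct mh h_cvg _ => n w; rewrite h0 hM.
under [RHS]eq_integral do rewrite hE.
apply: (cvg_unique _ lhs) => //; apply: cvg_trans rhs.
apply: near_eq_cvg; apply: nearW => n /=.
have UN : setT = \bigcup_k (N n @^-1` [set k]).
  by apply/seteqP; split => // w _; exists (N n w).
have tN : trivIset setT (fun k => N n @^-1` [set k]).
  by apply: trivIset_preimage1.
rewrite UN !ge0_integral_bigcup//.
- apply: eq_eseriesr => k _.
  transitivity (\int[P]_(w in N n @^-1` [set k]) (h (k%:R / n.+1%:R))%:E)%E.
    by apply: eq_integral => w; rewrite inE/= /tau_ => ->.
  transitivity (\int[P]_(w in N n @^-1` [set k])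
      (f (X (k%:R / n.+1%:R) w))%:E)%E; last first.
    by apply: eq_integral => w; rewrite inE/= /tau_ => ->.
  rewrite integral_cst//= integral_indep_event//.
    by rewrite hE muleC.
  (* [N n] is a successor, so the piece of index [0] is empty; the others are preimages of intervals
     under [tau]. *)
  case: k => [B _|k B mB]; first by rewrite N_0 set0I measure0 mul0e.
  by rewrite N_itv setIC indep// muleC.
- by rewrite -UN; exact/measurable_EFinP.
- by move=> w _; rewrite lee_fin.
- by rewrite -UN; exact/measurable_EFinP.
- by move=> w _; rewrite lee_fin.
Qed.


Let integral_min_cvg (g : T -> R) : measurable_fun setT g ->
  (forall w, 0 <= g w) ->
  (\int[P]_w (Num.min (g w) n%:R)%:E)%E @[n --> \oo] --> (\int[P]_w (g w)%:E)%E.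
Proof.
move=> mg g0.
have := @cvg_monotone_convergence _ _ _ P setT measurableT
  (fun n w => (Num.min (g w) n%:R)%:E).
have -> : (\int[P]_w limn (fun n => (Num.min (g w) n%:R)%:E) =
    \int[P]_w (g w)%:E)%E.
  apply: eq_integral => w _; apply/cvg_lim => //.
  apply: cvg_near_cst; near=> n; congr EFin; apply/min_idPl.
  near: n; exists (Num.truncn (g w)).+1 => // n /= wn.
  have /andP[_ h] := truncn_itv (g0 w).
  by rewrite (le_trans (ltW h))// ler_nat.
apply.
- move=> n; apply/measurable_EFinP; apply: measurable_minr => //.
- by move=> n w _; rewrite lee_fin le_min g0/=.
- move=> w _ m n mn; rewrite lee_fin le_min !ge_min lexx/= ler_nat mn orbT.
  by [].
Unshelve. all: by end_near. Qed.

(** Truncating [f] at level [n] and using monotone convergence removes the bound. This matters for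
    [exp (- u x)], which is unbounded on the real line, where [Y] may take negative values. *)
Lemma integral_random_time (f : R -> R) :
  continuous f -> (forall x, 0 <= f x) ->
  (\int[P]_w (f (X (tau w) w))%:E =
   \int[P]_w \int[P]_v (f (X (tau w) v))%:E)%E.
Proof.
move=> cf f0.
have mf : measurable_fun setT f by exact: continuous_measurable_fun.
pose f_ n x := Num.min (f x) n%:R.
have cf_ n : continuous (f_ n).
  move=> x; apply: (@continuous_min _ _ f (cst n%:R)); first exact: cf.
  exact: cst_continuous.
have f_n n x : 0 <= f_ n x <= n%:R.
  by rewrite /f_ le_min f0 ler0n ge_min lexx orbT.
have bnd n := integral_random_time_bounded (cf_ n) (f_n n).
have lhs := integral_min_cvg
  (measurableT_comp mf measurable_random_time) (fun w => f0 (X (tau w) w)).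
apply: (cvg_unique _ lhs) => //.
have -> : (fun n => \int[P]_w (Num.min (f (X (tau w) w)) n%:R)%:E)%E =
    (fun n => \int[P]_w \int[P]_v (f_ n (X (tau w) v))%:E)%E.
  by apply/funext => n; case: (bnd n) => _ <-.
have f_nd x : nondecreasing_seq (fun n => f_ n x).
  move=> m n mn; rewrite /f_ le_min !ge_min lexx/= ler_nat mn orbT.
  by [].
have mf_X n w : measurable_fun setT (fun v => (f_ n (X (tau w) v))%:E).
  apply/measurable_EFinP; apply: measurableT_comp => //.
  exact: continuous_measurable_fun.
have := @cvg_monotone_convergence _ _ _ P setT measurableT
  (fun n w => \int[P]_v (f_ n (X (tau w) v))%:E)%E.
have -> : (\int[P]_w limn (fun n => \int[P]_v (f_ n (X (tau w) v))%:E) =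
    \int[P]_w \int[P]_v (f (X (tau w) v))%:E)%E.
  apply: eq_integral => w _; apply/cvg_lim => //.
  by apply: integral_min_cvg => //; exact: measurableT_comp.
apply.
- by move=> n; case: (bnd n).
- move=> n w _; apply: integral_ge0 => v _.
  by rewrite lee_fin; case/andP: (f_n n (X (tau w) v)).
- move=> w _ m n mn; apply: ge0_le_integral => //.
  + by move=> v _; rewrite lee_fin; case/andP: (f_n m (X (tau w) v)).
  + by move=> v _; rewrite lee_fin f_nd.
Qed.

End random_time.

(** * Behaviour at zero of the Laplace exponents and of their composition *)

Section laplace_exponent_asymptotics.
Context {R : realType}.
Notation mu := (@lebesgue_measure R).

(** On (0, x) the factor [exp (- y)] lies between [exp (- x)] and [1], and the remaining power
    integrates exactly. The same bounds show that the extended integral is finite, so that its real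
    value is meaningful. *)
Lemma lower_gamma_bounds (a x : R) : 0 < a -> 0 <= x ->
  expR (- x) * (a^-1 * x `^ a) <= lower_gamma a x <= a^-1 * x `^ a.
Proof.
move=> a0; rewrite le_eqVlt => /predU1P[<-|x0].
  by rewrite /lower_gamma set_itvoo0 Rintegral_set0 powR0 ?gt_eqF// !mulr0 lexx.
have mf : measurable_fun `]0, x[ (fun y : R => (y `^ (a - 1))%:E).
  by apply/measurable_EFinP; apply: measurable_funTS; exact: measurable_powR.
have mg : measurable_fun `]0, x[ (fun y : R => (expR (- y) * y `^ (a - 1))%:E).
  apply/measurable_EFinP; apply: measurable_funM; last exact/measurable_EFinP.
  by apply: measurable_funTS; exact: measurableT_comp.
have le2 : (\int[mu]_(y in `]0%R, x[) (expR (- y) * y `^ (a - 1))%:E <=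
    (a^-1 * x `^ a)%:E)%E.
  rewrite -integral_powR_head//; apply: ge0_le_integral => //.
  - by move=> y _; rewrite lee_fin mulr_ge0 ?expR_ge0 ?powR_ge0.
  - move=> y /=; rewrite in_itv/= => /andP[y0 _].
    by rewrite lee_fin ler_piMl ?powR_ge0// -expR0 ler_expR oppr_le0 ltW.
have le1 : ((expR (- x) * (a^-1 * x `^ a))%:E <=
    \int[mu]_(y in `]0%R, x[) (expR (- y) * y `^ (a - 1))%:E)%E.
  rewrite EFinM -integral_powR_head// -ge0_integralZl_EFin ?expR_ge0//;
    last by move=> y _; rewrite lee_fin powR_ge0.
  apply: ge0_le_integral => //.
  - by move=> y _; rewrite -EFinM lee_fin mulr_ge0 ?expR_ge0 ?powR_ge0.
  - exact: measurable_funeM.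
  - move=> y /=; rewrite in_itv/= => /andP[_ yx].
    by rewrite -EFinM lee_fin ler_wpM2r ?powR_ge0// ler_expR lerN2 ltW.
have fin : (\int[mu]_(y in `]0%R, x[) (expR (- y) * y `^ (a - 1))%:E)%E
    \is a fin_num.
  rewrite fin_numE; apply/andP; split; apply/eqP => h.
    by move: le1; rewrite h.
  by move: le2; rewrite h.
by rewrite -!lee_fin /lower_gamma /Rintegral fineK// le1 le2.
Qed.

Lemma InG_exponent_bounds (a e x : R) : 0 < a -> 0 < e -> 0 <= x ->
  expR (- (x * e)) * x `^ a <= a / e `^ a * lower_gamma a (x * e) <= x `^ a.
Proof.
move=> a0 e0 x0; have := lower_gamma_bounds a0 (mulr_ge0 x0 (ltW e0)).
have ea0 : 0 < e `^ a by rewrite powR_gt0.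
have ae0 : 0 < a / e `^ a by rewrite divr_gt0.
rewrite powRM ?(ltW e0)// => /andP[h1 h2].
apply/andP; split.
  have -> : expR (- (x * e)) * x `^ a = a / e `^ a *
      (expR (- (x * e)) * (a^-1 * (x `^ a * e `^ a))).
    by field; rewrite !gt_eqF.
  by rewrite ler_wpM2l// ltW.
have -> : x `^ a = a / e `^ a * (a^-1 * (x `^ a * e `^ a)).
  by field; rewrite !gt_eqF.
by rewrite ler_wpM2l// ltW.
Qed.

(** Convergence at a single point [y > 0] bounds the terms [c k * y ^+ k], so for [x <= y / 2] the
    terms after the [m]-th are dominated by a geometric series in [x / y]; their sum is of order
    [x ^+ m.+1]. *)
Lemma power_series_first_term (c : nat -> R) (f : R -> R) (m : nat) :
  (1 <= m)%N -> (forall k, (1 <= k < m)%N -> c k = 0) ->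
  (\forall x \near 0^'+, \sum_(1 <= k < n) c k * x ^+ k @[n --> \oo] --> f x) ->
  f x / x ^+ m @[x --> 0^'+] --> c m.
Proof.
move=> m1 cm [e /= e0 he].
have hs (x : R) : 0 < x -> x < e ->
    \sum_(1 <= k < n) c k * x ^+ k @[n --> \oo] --> f x.
  move=> x0 xe; apply: he => //=.
  by rewrite sub0r normrN gtr0_norm.
pose y := e / 2.
have y0 : 0 < y by rewrite divr_gt0.
have ye : y < e by rewrite gtr_pMr// invf_lt1// ltr1n.
have [M M0 hM] : exists2 M : R, 0 <= M &
    forall k, (1 <= k)%N -> `|c k * y ^+ k| <= M.
  have cs := hs _ y0 ye.
  have bs : bounded_fun (fun n => \sum_(1 <= k < n) c k * y ^+ k).
    by apply: cvg_seq_bounded; apply/cvg_ex; exists (f y).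
  have [K [_ hK]] := bs.
  have K1 := hK (`|K| + 1) (ltr_pwDr ltr01 (ler_norm K)).
  (* A term is the difference of two consecutive partial sums, whence the factor [2]. *)
  exists (2 * (`|K| + 1)) => [|k k1]; first by rewrite mulr_ge0// addr_ge0.
  have -> : c k * y ^+ k = \sum_(1 <= i < k.+1) c i * y ^+ i -
      \sum_(1 <= i < k) c i * y ^+ i
    by rewrite big_nat_recr//= addrAC subrr add0r.
  rewrite mulr_natl mulr2n (le_trans (ler_normB _ _))// lerD//; exact: K1.
(* The subtracted [n]-th power makes the induction close: both sides vanish at [n = m.+1], and
   adding a term costs [M q^n], which is at most [2 M (q^n - q^(n+1))] because [q <= 1/2]. *)
have bound (x : R) n : 0 < x -> x <= y / 2 -> (m < n)%N ->
    `|\sum_(1 <= k < n) c k * x ^+ k - c m * x ^+ m|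
      <= 2 * M * ((x / y) ^+ m.+1 - (x / y) ^+ n).
  move=> x0 xy; pose q : R := x / y; rewrite -/q.
  have q0 : 0 < q by rewrite divr_gt0.
  have q2 : q <= 2^-1 by rewrite ler_pdivrMr// mulrC.
  elim: n => // n IH; rewrite ltnS leq_eqVlt => /predU1P[<-|mn].
    rewrite subrr mulr0 big_nat_recr//= big_nat big1 ?add0r ?subrr ?normr0//.
    by move=> k /cm ->; rewrite mul0r.
  rewrite big_nat_recr/=; last exact: leq_trans m1 (ltnW mn).
  rewrite addrAC (le_trans (ler_normD _ _))//.
  apply: (@le_trans _ _ (2 * M * (q ^+ m.+1 - q ^+ n) + M * q ^+ n)).
    rewrite lerD ?IH//.
    have -> : c n * x ^+ n = (c n * y ^+ n) * q ^+ n.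
      by rewrite -mulrA -exprMn /q mulrCA divff ?mulr1// gt_eqF.
    rewrite normrM [`|q ^+ n|]ger0_norm ?exprn_ge0 ?(ltW q0)//.
    rewrite ler_wpM2r ?exprn_ge0 ?(ltW q0)// hM//.
    exact: leq_trans m1 (ltnW mn).
  have MQ : 0 <= M * q ^+ n by rewrite mulr_ge0 ?exprn_ge0 ?(ltW q0).
  have := ler_wpM2l MQ q2.
  rewrite [q ^+ n.+1]exprS; move: (q ^+ n) (q ^+ m.+1) => Q Q' h.
  rewrite -subr_ge0; rewrite -subr_ge0 in h.
  have -> : 2 * M * (Q' - q * Q) - (2 * M * (Q' - Q) + M * Q) =
      2 * (M * Q / 2 - M * Q * q) by field.
  by rewrite mulr_ge0.
pose K := 2 * M / y ^+ m.+1.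
have fK (x : R) : 0 < x -> x <= y / 2 -> `|f x / x ^+ m - c m| <= K * x.
  move=> x0 xy.
  have xe : x < e.
    apply: le_lt_trans xy _; rewrite (lt_trans _ ye)// gtr_pMr// invf_lt1//.
    by rewrite ltr1n.
  have h : `|f x - c m * x ^+ m| <= 2 * M * (x / y) ^+ m.+1.
    have cvn : `|\sum_(1 <= k < n) c k * x ^+ k - c m * x ^+ m| @[n --> \oo] -->
        `|f x - c m * x ^+ m|.
      by apply: cvg_norm; apply: cvgB; [exact: hs|exact: cvg_cst].
    apply: (cvgr_to_le cvn).
    near=> n; apply: (le_trans (bound _ _ x0 xy _)).
      by near: n; exact: nbhs_infty_gt.
    rewrite ler_wpM2l ?mulr_ge0// lerBlDr lerDl exprn_ge0// divr_ge0// ltW//.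
  have xm0 : 0 < x ^+ m by rewrite exprn_gt0.
  have -> : f x / x ^+ m - c m = (f x - c m * x ^+ m) / x ^+ m.
    by rewrite mulrBl mulfK// gt_eqF.
  rewrite normrM normfV (gtr0_norm xm0) ler_pdivrMr//.
  apply: (le_trans h); rewrite /K expr_div_n exprS le_eqVlt; apply/orP; left.
  by apply/eqP; field; rewrite expf_neq0 ?gt_eqF.
have K0 : 0 <= K by rewrite /K divr_ge0 ?mulr_ge0 ?exprn_ge0// ltW.
have K1 : 0 < K + 1 by rewrite ltr_pwDr.
apply/cvgrPdist_le => d d0; near=> x.
have x0 : 0 < x by [].
rewrite distrC (le_trans (fK _ x0 _))//.
  by near: x; apply: nbhs_right_le; rewrite divr_gt0.
apply: (@le_trans _ _ ((K + 1) * x)).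
  by rewrite ler_wpM2r ?(ltW x0)// lerDl.
rewrite mulrC -ler_pdivlMr//.
by near: x; apply: nbhs_right_le; rewrite divr_gt0.
Unshelve. all: by end_near. Qed.

Lemma InG_composition_asymptotics (psi : R -> R) (m : nat) (xi a e : R) :
  (1 <= m)%N -> 0 < a -> 0 < e -> 0 < xi ->
  (forall x, 0 < x -> 0 <= psi x) ->
  psi x / x ^+ m @[x --> 0^'+] --> xi ->
  (a / e `^ a * lower_gamma a (psi x * e)) / x `^ (m%:R * a)
    @[x --> 0^'+] --> xi `^ a.
Proof.
move=> m1 a0 e0 xi0 psi0 psi_cvg.
have ratio : (psi x / x ^+ m) `^ a @[x --> 0^'+] --> xi `^ a.
  apply: (@continuous_cvg _ _ _ _ _ _ (fun y : R => y `^ a)) => //.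
  exact: continuous_powR.
have x0 : (x : R) @[x --> 0^'+] --> (0 : R).
  exact: cvg_at_right_filter.
(* This limit, due to [m >= 1], sends the factor [exp (- (psi x * e))] of the lower bound to [1], so
   that the two bounds merge. *)
have psi_0 : psi x @[x --> 0^'+] --> 0.
  have h : psi x / x ^+ m * x ^+ m @[x --> 0^'+] --> xi * 0 ^+ m.
    apply: cvgM => //.
    apply: (@continuous_cvg _ _ _ _ _ _ (fun x : R => x ^+ m)) => //.
    exact: exprn_continuous.
  rewrite expr0n eqn0Ngt m1 mulr0 in h.
  apply: cvg_trans h; apply: near_eq_cvg; near=> x.
  by rewrite divfK// expf_neq0// gt_eqF.
have lower :
    expR (- (psi x * e)) * (psi x / x ^+ m) `^ a @[x --> 0^'+] --> xi `^ a.
  have -> : xi `^ a = expR (- (0 * e)) * xi `^ a.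
    by rewrite mul0r oppr0 expR0 mul1r.
  apply: cvgM => //; apply: continuous_cvg; first exact: continuous_expR.
  by apply: cvgN; apply: cvgMr_tmp.
apply: squeeze_cvgr lower ratio; near=> x.
have xp : 0 < x by [].
have xE : (psi x / x ^+ m) `^ a = psi x `^ a / x `^ (m%:R * a).
  rewrite powRM ?psi0 ?invr_ge0 ?exprn_ge0 ?(ltW xp)//; congr (_ * _).
  rewrite -powR_inv1 ?exprn_ge0 ?(ltW xp)// -powRrM mulN1r powRN.
  by rewrite -powR_mulrn ?(ltW xp)// -powRrM.
have /andP[h1 h2] := InG_exponent_bounds a0 e0 (psi0 _ xp).
by rewrite xE mulrA !ler_wpM2r ?invr_ge0 ?powR_ge0.
Unshelve. all: by end_near. Qed.
End laplace_exponent_asymptotics.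

(** * Finiteness and rescaled limit of the fractional integral of an exponent *)

Section scaled_fractional_integral.
Context {R : realType}.
Notation mu := (@lebesgue_measure R).
Variables (F : R -> R) (b k p : R).
Hypothesis F_ge0 : forall x, 0 < x -> 0 <= F x.
Hypothesis measurable_F : measurable_fun (`]0, +oo[%classic : set R) F.
Hypothesis F_cvg : F x / x `^ b @[x --> 0^'+] --> k.
Hypotheses (k_gt0 : 0 < k) (p_gt0 : 0 < p) (pb : p < b).

Let b_gt0 : 0 < b. Proof. exact: lt_trans pb. Qed.

Let Gamma_arg : 0 < 1 - p / b < 1.
Proof.
by rewrite subr_gt0 ltr_pdivrMr// mul1r pb/= ltrBlDr ltrDl divr_gt0.
Qed.

Let F_bound : exists A e : R, [/\ 0 < A, 0 < e &
  forall x : R, 0 < x -> x <= e -> F x <= A * x `^ b].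
Proof.
have k1 : k < k + 1 by rewrite ltrDl.
have [e /= e0 he] := cvgr_le _ F_cvg _ k1.
exists (k + 1), (e / 2); split; [by rewrite addr_gt0|by rewrite divr_gt0|].
move=> x x0 xe; rewrite -ler_pdivrMr ?powR_gt0//; apply: he => //=.
rewrite sub0r normrN gtr0_norm// (le_lt_trans xe)//.
by rewrite ltr_pdivrMr// ltr_pMr// ltr1n.
Qed.

(* Near [0] this is [t F(l u) <= D A u^b]; away from [0] the right-hand side is
   at least [1], because [C u^b >= 1] and [2 (1 - e^-1) >= 1]. *)
Lemma one_subr_expR_bound (D : R) : exists2 C : R, 0 < C &
  forall t l u : R, 0 <= t -> 0 < l <= 1 -> t * l `^ b <= D -> 0 < u ->
    1 - expR (- (t * F (l * u))) <= 2 * (1 - expR (- (C * u `^ b))).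
Proof.
have [A [e [A0 e0 FA]]] := F_bound.
pose C := Num.max (D * A) (e `^ b)^-1.
have C0 : 0 < C by rewrite lt_max invr_gt0 powR_gt0// orbT.
exists C => // t l u t0 /andP[l0 l1] tlD u0.
have ub0 := powR_ge0 u b.
have [ue|eu] := leP u e.
- apply: (@le_trans _ _ (1 - expR (- (C * u `^ b)))); last first.
    rewrite ler_peMl ?ler1n// subr_ge0 -expR0 ler_expR oppr_le0 mulr_ge0//.
    exact: ltW.
  rewrite lerD2l lerN2 ler_expR lerN2.
  apply: (@le_trans _ _ (t * (A * (l * u) `^ b))).
    rewrite ler_wpM2l// FA ?mulr_gt0// (le_trans _ ue)//.
    by rewrite ler_piMl ?(ltW u0).
  rewrite powRM ?(ltW l0) ?(ltW u0)//.
  have -> : t * (A * (l `^ b * u `^ b)) = t * l `^ b * A * u `^ b by ring.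
  rewrite ler_wpM2r// le_max; apply/orP; left.
  by rewrite ler_wpM2r// ltW.
- apply: (@le_trans _ _ 1); first by rewrite lerBlDr lerDl expR_ge0.
  have C1 : 1 <= C * u `^ b.
    apply: (@le_trans _ _ ((e `^ b)^-1 * u `^ b)); last first.
      by rewrite ler_wpM2r// le_max lexx orbT.
    rewrite mulrC ler_pdivlMr ?powR_gt0// mul1r.
    apply: ge0_ler_powR; rewrite ?nnegrE ?(ltW e0) ?(ltW u0) ?(ltW eu)//.
    exact: ltW.
  have : expR (- (C * u `^ b)) <= 2^-1.
    apply: (@le_trans _ _ (expR (- 1))); first by rewrite ler_expR lerN2.
    rewrite expRN lef_pV2 ?posrE ?expR_gt0//.
    by have := expR_ge1Dx (1 : R); lra.
  lra.
Qed.

Let J (t l u : R) : R := u `^ (- p - 1) * (1 - expR (- (t * F (l * u)))).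

Let dom (C u : R) : R := 2 * (u `^ (- p - 1) * (1 - expR (- (C * u `^ b)))).

Let dom_ge0 C u : 0 < C -> 0 <= dom C u.
Proof.
move=> C0; rewrite !mulr_ge0 ?powR_ge0// subr_ge0 -expR0 ler_expR oppr_le0.
by rewrite mulr_ge0 ?powR_ge0 ?(ltW C0).
Qed.

Let J_ge0 t l u : 0 <= t -> 0 < l -> 0 < u -> 0 <= J t l u.
Proof.
move=> t0 l0 u0; rewrite mulr_ge0 ?powR_ge0// subr_ge0 -expR0 ler_expR oppr_le0.
by rewrite mulr_ge0 ?F_ge0// mulr_gt0.
Qed.

Let measurable_kernel (g : R -> R) :
  measurable_fun (`]0, +oo[%classic : set R) g ->
  measurable_fun (`]0, +oo[%classic : set R)
    (fun u => u `^ (- p - 1) * (1 - expR (- (g u)))).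
Proof.
move=> mg; apply: measurable_funM.
  by apply: measurable_funTS; exact: measurable_powR.
apply: measurable_funB => //; apply: measurableT_comp => //.
exact: measurableT_comp.
Qed.

Let measurable_J t l : 0 < l ->
  measurable_fun (`]0, +oo[%classic : set R) (J t l).
Proof.
move=> l0; apply: measurable_kernel; apply: measurable_funM => //.
apply: (@measurable_comp _ _ _ _ _ _ (`]0, +oo[%classic : set R) F _
  (fun x : R => l * x)) => //.
- by move=> _ [x /= + <-]; rewrite !in_itv/= !andbT => x0; rewrite mulr_gt0.
- by apply: measurable_funTS; exact: measurable_funM.
Qed.

Let measurable_powR_exp C :
  measurable_fun (`]0, +oo[%classic : set R)
    (fun u => u `^ (- p - 1) * (1 - expR (- (C * u `^ b)))).
Proof.
by apply: measurable_kernel; apply: measurable_funTS; apply: measurable_funM.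
Qed.

Let measurable_dom C : measurable_fun (`]0, +oo[%classic : set R) (dom C).
Proof. by apply: measurable_funM => //; exact: measurable_powR_exp. Qed.

(** Up to constants the integral is [Gamma (1 - p / b)], and [p < b] is what makes it finite. *)
Let integrable_dom C : 0 < C -> mu.-integrable `]0, +oo[ (EFin \o dom C).
Proof.
move=> C0; apply/integrableP; split.
  by apply/measurable_EFinP; exact: measurable_dom.
under eq_integral do rewrite /= ger0_norm ?dom_ge0//.
rewrite /dom; under eq_integral do rewrite EFinM.
rewrite ge0_integralZl_EFin//; last 2 first.
- move=> u _; have := dom_ge0 u C0; rewrite /dom lee_fin pmulr_rge0//.
- by apply/measurable_EFinP; exact: measurable_powR_exp.
by rewrite integral_powR_expR// GammaE// -!EFinM ltry.
Qed.

Let J_le_dom (D C : R) : (forall t l u : R, 0 <= t -> 0 < l <= 1 ->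
    t * l `^ b <= D -> 0 < u ->
    1 - expR (- (t * F (l * u))) <= 2 * (1 - expR (- (C * u `^ b)))) ->
  forall t l u, 0 <= t -> 0 < l <= 1 -> t * l `^ b <= D -> 0 < u ->
  J t l u <= dom C u.
Proof.
move=> h t l u t0 l01 tlD u0; rewrite /J /dom mulrCA ler_wpM2l ?powR_ge0//.
exact: h.
Qed.

Lemma fractional_integral_lty t : 0 <= t ->
  (\int[mu]_(u in `]0%R, +oo[)
    (u `^ (- p - 1) * (1 - expR (- (t * F u))))%:E < +oo)%E.
Proof.
(* Without rescaling, [l = 1] and the product [t * l^b] is [t] itself. *)
move=> t0; have [C C0 /J_le_dom h] := one_subr_expR_bound t.
have -> : (\int[mu]_(u in `]0%R, +oo[)
    (u `^ (- p - 1) * (1 - expR (- (t * F u))))%:E =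
    \int[mu]_(u in `]0%R, +oo[) (J t 1 u)%:E)%E.
  by apply: eq_integral => u _; rewrite /J mul1r.
have /integrableP[_ +] := integrable_dom C0; apply: le_lt_trans.
apply: ge0_le_integral => //.
- by move=> u /=; rewrite in_itv/= andbT => u0; rewrite lee_fin J_ge0.
- by apply/measurable_EFinP; exact: measurable_J.
- apply: measurableT_comp => //; apply/measurable_EFinP; exact: measurable_dom.
- move=> u /=; rewrite in_itv/= andbT => u0.
  by rewrite lee_fin (le_trans _ (ler_norm _))// h// ?lexx ?ltr01// powR1 mulr1.
Qed.

Let J_cvg u : 0 < u ->
  J t (t `^ (- b^-1)) u @[t --> +oo] -->
  u `^ (- p - 1) * (1 - expR (- (k * u `^ b))).
Proof.
move=> u0; have bV0 : 0 < b^-1 by rewrite invr_gt0.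
apply: cvgMl_tmp; apply: cvgB; first exact: cvg_cst.
apply: continuous_cvg; first exact: continuous_expR.
apply: cvgN.
have l_cvg : t `^ (- b^-1) * u @[t --> +oo] --> 0^'+.
  move=> A [e /= e0 hA].
  have /cvgrPdist_lt/(_ (e / u) (divr_gt0 e0 u0)) lt_eu := cvg_powR_pinfty bV0.
  have gt0 : \forall t \near +oo, (0 : R) < t by exact: nbhs_pinfty_gt.
  change (\forall t \near +oo, A (t `^ (- b^-1) * u)).
  apply: filterS2 gt0 lt_eu => t t0.
  rewrite sub0r normrN ger0_norm ?powR_ge0// ltr_pdivlMr// => te.
  have tu0 : 0 < t `^ (- b^-1) * u by rewrite mulr_gt0// powR_gt0.
  by apply: hA => //=; rewrite sub0r normrN gtr0_norm.
have := cvg_comp _ _ l_cvg F_cvg => h.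
have {}h : (fun t : R =>
    F (t `^ (- b^-1) * u) / (t `^ (- b^-1) * u) `^ b * u `^ b)
    @ +oo --> k * u `^ b.
  by apply: cvgM => //; exact: cvg_cst.
(* With [l = t^(-1/b)] one has [(l u)^b = u^b / t], so the ratio at [l u] times [u^b] is exactly
   [t F(l u)]. *)
apply: cvg_trans h; apply: near_eq_cvg; near=> t.
have t0 : 0 < t by [].
rewrite powRM ?powR_ge0 ?(ltW u0)// -powRrM mulNr mulVf ?gt_eqF//.
rewrite powR_inv1 ?(ltW t0)//; field.
by rewrite !gt_eqF// powR_gt0.
Unshelve. all: by end_near. Qed.

Lemma scaled_fractional_integral_cvg :
  fine (\int[mu]_(u in `]0%R, +oo[)
    (u `^ (- p - 1) * (1 - expR (- (t * F (t `^ (- b^-1) * u)))))%:E)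
  @[t --> +oo] --> p^-1 * k `^ (p / b) * Gamma (1 - p / b).
Proof.
apply/cvg_pinftyP => s s_cvg.
have [C C0 /J_le_dom h] := one_subr_expR_bound 1.
(* Domination is required for every [n], and it needs [l <= 1], that is [t >= 1]; the cut-off
   changes only finitely many terms. The identity [t * l^b = 1] explains the constant [1] given to
   the bound. *)
pose t n := Num.max (s n) 1.
have t1 n : 1 <= t n by rewrite le_max lexx orbT.
have t0 n : 0 < t n := lt_le_trans ltr01 (t1 n).
have ts : \forall n \near \oo, t n = s n.
  move/cvgryPge : s_cvg => /(_ 1); apply: filterS => n sn.
  exact/max_idPl.
have t_cvg : t n @[n --> \oo] --> +oo.
  apply: cvg_trans s_cvg; apply: near_eq_cvg; apply: filterS ts => n -> //.
pose l n := t n `^ (- b^-1).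
have l0 n : 0 < l n by rewrite powR_gt0.
have l1 n : l n <= 1.
  rewrite -(powRr0 (t n)) ler_powR// oppr_le0 invr_ge0 ltW//.
have tl n : t n * l n `^ b = 1.
  rewrite -powRrM mulNr mulVf ?gt_eqF// powR_inv1 ?(ltW (t0 n))//.
  by rewrite divff// gt_eqF.
have := @dominated_convergence _ _ _ mu `]0%R, +oo[%classic (measurable_itv _)
  (fun n u => (J (t n) (l n) u)%:E)
  (fun u => (u `^ (- p - 1) * (1 - expR (- (k * u `^ b))))%:E)
  (EFin \o dom C).
case.
- by move=> n; apply/measurable_EFinP; exact: measurable_J.
- by apply/measurable_EFinP; exact: measurable_powR_exp.
- apply: aeW => u; rewrite /= in_itv/= andbT => u0.
  apply: cvg_EFin; first exact: nearW.
  by have /cvg_pinftyP := J_cvg u0; exact.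
- exact: integrable_dom.
- apply: aeW => u n; rewrite /= in_itv/= andbT => u0.
  rewrite lee_fin ger0_norm ?J_ge0 ?(ltW (t0 n))//.
  by rewrite h ?(ltW (t0 n)) ?l0 ?l1 ?tl.
move=> _ _; rewrite integral_powR_expR// GammaE// -EFinM.
move/fine_cvg; apply: cvg_trans; apply: near_eq_cvg.
by apply: filterS ts => n tsn; rewrite /= /l /J tsn.
Qed.
End scaled_fractional_integral.

(** * Fractional moments of an almost surely non-negative variable from its Laplace transform *)

Section fractional_moment.
Context {d : measure_display} {T : measurableType d} {R : realType}.
Notation mu := (@lebesgue_measure R).
Variables (P : probability T R) (Z : T -> R).
Hypothesis measurable_Z : measurable_fun setT Z.

(** [Z] may be negative on a null set, where its real powers are mere default values. Pointwise
    identities are proved for the positive part, which has the same integrals. *)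
Let Zp w := Num.max (Z w) 0.

Let Zp_ge0 w : 0 <= Zp w. Proof. by rewrite le_max lexx orbT. Qed.

Let measurable_Zp : measurable_fun setT Zp.
Proof. exact: measurable_maxr. Qed.

Hypothesis Z_ge0 : {ae P, forall w, 0 <= Z w}.

Let integral_Zp (f : R -> R) : measurable_fun setT f -> (forall x, 0 <= f x) ->
  (\int[P]_w (f (Z w))%:E = \int[P]_w (f (Zp w))%:E)%E.
Proof.
move=> mf f0; apply: ge0_ae_eq_integral => //.
- by apply/measurable_EFinP; exact: measurableT_comp.
- by apply/measurable_EFinP; exact: measurableT_comp.
- by move=> w _; rewrite lee_fin.
- by move=> w _; rewrite lee_fin.
- apply: filterS Z_ge0 => w Zw _; rewrite /Zp; congr ((f _)%:E).
  by rewrite max_l.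
Qed.

Lemma integral_powRZ (l p : R) : 0 <= l ->
  (\int[P]_w ((l * Z w) `^ p)%:E = (l `^ p)%:E * \int[P]_w (Z w `^ p)%:E)%E.
Proof.
move=> l0.
rewrite (integral_Zp (f := fun x => (l * x) `^ p)); last 2 first.
- by apply: (measurableT_comp (measurable_powR p)); exact: measurable_funM.
- by move=> x; exact: powR_ge0.
rewrite (integral_Zp (f := fun x => x `^ p)); last 2 first.
- exact: measurable_powR.
- by move=> x; exact: powR_ge0.
rewrite -ge0_integralZl_EFin ?powR_ge0//.
- by apply: eq_integral => w _; rewrite powRM// EFinM.
- by move=> w _; rewrite lee_fin powR_ge0.
- by apply/measurable_EFinP; apply: (measurableT_comp (measurable_powR p)).
Qed.

Lemma integral_expR_le1 (u : R) : 0 <= u ->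
  (\int[P]_w (expR (- (u * Z w)))%:E <= 1)%E.
Proof.
move=> u0; rewrite (integral_Zp (f := fun x => expR (- (u * x)))); last 2 first.
- apply: measurableT_comp => //; apply: measurableT_comp => //.
- by move=> x; exact: expR_ge0.
rewrite -(probability_setT P) -[leRHS]mul1e -integral_cst//.
apply: ge0_le_integral => //.
- apply/measurable_EFinP; apply: measurableT_comp => //.
  by apply: measurableT_comp => //; exact: measurable_funM.
- move=> w _; rewrite lee_fin -[leRHS]expR0 ler_expR oppr_le0 mulr_ge0//.
Qed.

Variable G : R -> R.
Hypothesis laplace_Z : forall u : R, 0 < u ->
  (\int[P]_w (expR (- (u * Z w)))%:E = (expR (- G u))%:E)%E.

Let laplace_Zp u : 0 < u ->
  (\int[P]_w (expR (- (u * Zp w)))%:E = (expR (- G u))%:E)%E.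
Proof.
move=> u0; rewrite -laplace_Z//.
rewrite [RHS](integral_Zp (f := fun x => expR (- (u * x))))//.
by apply: measurableT_comp => //; apply: measurableT_comp.
Qed.

(** On positive arguments [G] is minus the logarithm of the Laplace transform, and the latter is
    measurable in [u] by the measurability half of Tonelli's theorem. *)
Lemma measurable_laplace_exponent :
  measurable_fun (`]0, +oo[%classic : set R) G.
Proof.
pose f (z : R * T) : \bar R := (expR (- (z.1 * Zp z.2)))%:E.
have mf : measurable_fun setT f.
  apply/measurable_EFinP; apply: measurableT_comp => //.
  apply: measurableT_comp => //; apply: measurable_funM => //.
  exact: (measurableT_comp measurable_Zp).
have f0 (z : R * T) : (0 <= f z)%E by rewrite lee_fin expR_ge0.
have mL := measurable_fun_fubini_tonelli_F (m2 := P) f mf f0.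
apply: (eq_measurable_fun (fun u => - ln (fine (\int[P]_w f (u, w)))%E)).
  move=> u; rewrite inE/= in_itv/= andbT => u0.
  by rewrite /f/= laplace_Zp//= expRK opprK.
apply: measurable_funTS; apply: measurableT_comp => //.
apply: measurableT_comp => //; exact: measurableT_comp.
Qed.

(** The equality holds in the extended reals, so finiteness of the moment can be read off from the
    right-hand side. *)
Lemma fractional_moment_laplace (p : R) : 0 < p < 1 ->
  (\int[P]_w (Z w `^ p)%:E * (p^-1 * Gamma (1 - p))%:E =
   \int[mu]_(u in `]0%R, +oo[) (u `^ (- p - 1) * (1 - expR (- G u)))%:E)%E.
Proof.
move=> /andP[p0 p1].
have G1p : 0 < 1 - p < 1 by rewrite subr_gt0 p1/= ltrBlDr ltrDl.
have K0 : 0 <= p^-1 * Gamma (1 - p).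
  by rewrite mulr_ge0 ?invr_ge0 ?(ltW p0)// ltW// Gamma_gt0.
have kernel x : 0 <= x -> (\int[mu]_(u in `]0%R, +oo[)
    (u `^ (- p - 1) * (1 - expR (- (u * x))))%:E =
    (p^-1 * Gamma (1 - p) * x `^ p)%:E)%E.
  rewrite le_eqVlt => /predU1P[<-|x0].
    rewrite powR0 ?gt_eqF// mulr0 integral0_eq// => u _.
    by rewrite mulr0 oppr0 expR0 subrr mulr0.
  have := integral_powR_expR p0 ltr01 x0; rewrite divr1 GammaE// -EFinM.
  rewrite mulrAC => <-; apply: eq_integral => u.
  rewrite inE/= in_itv/= andbT => u0.
  by rewrite powRr1 ?(ltW u0)// [u * x]mulrC.
pose f (z : T * R) : \bar R := (if 0 < z.2
  then z.2 `^ (- p - 1) * (1 - expR (- (z.2 * Zp z.1))) else 0)%:E.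
have mf : measurable_fun setT f.
  apply/measurable_EFinP; apply: measurable_fun_ifT => //.
    exact: measurable_fun_ltr.
  apply: measurable_funM; first exact: (measurableT_comp (measurable_powR _)).
  apply: measurable_funB => //; apply: measurableT_comp => //.
  apply: measurableT_comp => //; apply: measurable_funM => //.
  exact: (measurableT_comp measurable_Zp).
have f0 (z : T * R) : (0 <= f z)%E.
  rewrite lee_fin; case: ifPn => // z0; rewrite mulr_ge0 ?powR_ge0//.
  by rewrite subr_ge0 -[leRHS]expR0 ler_expR oppr_le0 mulr_ge0// ltW.
have := fubini_tonelli (m1 := P) (m2 := mu) f mf f0.
have -> : (\int[P]_w \int[mu]_u f (w, u) =
    \int[P]_w (Z w `^ p)%:E * (p^-1 * Gamma (1 - p))%:E)%E.
  rewrite (integral_Zp (f := fun x => x `^ p)); last 2 first.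
  - exact: measurable_powR.
  - by move=> x; exact: powR_ge0.
  rewrite muleC -ge0_integralZl_EFin//; last 2 first.
  - by move=> w _; rewrite lee_fin powR_ge0.
  - by apply/measurable_EFinP; apply: (measurableT_comp (measurable_powR p)).
  apply: eq_integral => w _; rewrite -EFinM -kernel// [RHS]integral_mkcond.
  apply: eq_integral => u _; rewrite patchE /f/= mem_setE in_itv/= andbT.
  by case: ifP.
move=> ->; rewrite [RHS]integral_mkcond; apply: eq_integral => u _.
rewrite patchE /f/= mem_setE in_itv/= andbT; case: ifPn => u0; last first.
  by rewrite integral0_eq.
have m1 : measurable_fun setT (fun w => (expR (- (u * Zp w)))%:E).
  apply/measurable_EFinP; apply: measurableT_comp => //.
  by apply: measurableT_comp => //; exact: measurable_funM.
have le1 w : expR (- (u * Zp w)) <= 1.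
  by rewrite -[leRHS]expR0 ler_expR oppr_le0 mulr_ge0// ltW.
under eq_integral do rewrite EFinM.
rewrite ge0_integralZl_EFin ?powR_ge0//; last 2 first.
- by move=> w _; rewrite lee_fin subr_ge0.
- apply/measurable_EFinP; apply: measurable_funB => //.
  exact/measurable_EFinP.
rewrite EFinM; congr (_ * _)%E.
under eq_integral do rewrite EFinB.
rewrite integralB_EFin//; last 2 first.
- exact: finite_measure_integrable_cst.
- apply/integrableP; split => //.
  under eq_integral do rewrite /= ger0_norm ?expR_ge0//.
  by rewrite laplace_Zp// ltry.
by rewrite laplace_Zp// integral_cst//= mul1e probability_setT EFinB.
Qed.

End fractional_moment.

(** * Laplace transform of the subordinated process and sign of the inner exponent *)

Section subordination.
Context {d : measure_display} {T : measurableType d} {R : realType}.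
Variables (P : probability T R) (Y S : R -> {RV P >-> R}).
Hypotheses (hY : levy_process Y) (hS : subordinator S).
Hypothesis hindep : indep_processes Y S.

Let S_ge0 t w : 0 <= t -> 0 <= S t w.
Proof. exact: subordinator_ge0. Qed.

Let Y_right_cont w (s : R) : 0 <= s -> Y u w @[u --> s^'+] --> Y s w.
Proof. by case: (levy_cadlag hY w) => + _; exact. Qed.

Let YS_indep t : 0 <= t -> forall (s : R) B C, 0 <= s ->
  measurable B -> measurable C ->
  (P (Y s @^-1` B `&` S t @^-1` C) = P (Y s @^-1` B) * P (S t @^-1` C))%E.
Proof.
move=> t0 s B C s0 mB mC; apply: hindep; apply: sub_sigma_algebra.
  by exists s, B; split => //=; rewrite in_itv/= s0.
by exists t, C; split => //=; rewrite in_itv/= t0.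
Qed.

Lemma measurable_subordinated t : 0 <= t ->
  measurable_fun setT (subordinated Y S t).
Proof.
move=> t0; apply: (measurable_random_time (tau := S t)) => //.
by move=> w; exact: S_ge0.
Qed.

(** The right-hand side stays an expectation over [S t]: the exponent of [S] applies at positive
    arguments only, and the sign of [psi u] is still to be found, by means of this very formula. *)
Lemma laplace_subordinated (psi : R -> R) t u : laplace_exponent Y psi ->
  0 <= t -> 0 < u ->
  (\int[P]_w (expR (- (u * subordinated Y S t w)))%:E =
   \int[P]_w (expR (- (S t w * psi u)))%:E)%E.
Proof.
move=> hpsi t0 u0.
rewrite (integral_random_time (X := Y) (tau := S t) _ _ _
  (f := fun x => expR (- (u * x)))).
- apply: eq_integral => w _.
  by have := hpsi (S t w) u (S_ge0 w t0) u0; rewrite unlock.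
- by move=> w; exact: S_ge0.
- exact: Y_right_cont.
- exact: YS_indep.
- move=> x; apply: continuous_comp; last exact: continuous_expR.
  by apply: continuousN; apply: continuousM => //; exact: cst_continuous.
- by move=> x; exact: expR_ge0.
Qed.

Hypothesis Q_ge0 :
  forall t : R, 0 <= t -> {ae P, forall w, 0 <= subordinated Y S t w}.

(* As [exp (a s) + a exp (- s) >= 1 + a] for [a, s >= 0], a negative value
   [psi u = - a] together with [E exp (a S_1) = E exp (- u Q_1) <= 1] would
   force [E exp (- S_1) >= 1]. *)
Lemma laplace_exponent_ge0 (psi phi : R -> R) u :
  laplace_exponent Y psi -> laplace_exponent S phi -> 0 < phi 1 ->
  0 < u -> 0 <= psi u.
Proof.
move=> hpsi hphi phi1 u0; rewrite leNgt; apply/negP => psi0.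
pose a := - psi u; have a0 : 0 < a by rewrite oppr_gt0.
have h1 : (\int[P]_w (expR (a * S 1 w))%:E <= 1)%E.
  have := integral_expR_le1 (measurable_subordinated ler01) (Q_ge0 ler01)
    (ltW u0).
  rewrite (laplace_subordinated hpsi ler01 u0).
  by under eq_integral do rewrite -mulrN mulrC.
have h2 : (\int[P]_w (expR (- S 1 w))%:E = (expR (- phi 1))%:E)%E.
  have := hphi 1 1 ler01 ltr01; rewrite unlock mul1r => <-.
  by apply: eq_integral => w _; rewrite mul1r.
have me : measurable_fun setT (fun w => (expR (- S 1 w))%:E).
  apply/measurable_EFinP; apply: measurableT_comp => //.
  exact: measurableT_comp.
have : ((1 + a)%:E <= 1 + (a * expR (- phi 1))%:E)%E.
  apply: (@le_trans _ _
      (\int[P]_w (expR (a * S 1 w) + a * expR (- S 1 w))%:E)%E).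
    rewrite -[leLHS]mule1 -(probability_setT P) -integral_cst//.
    apply: ge0_le_integral => //.
    - by move=> w _; rewrite lee_fin addr_ge0// ltW.
    - apply/measurable_EFinP; apply: measurable_funD.
        by apply: measurableT_comp => //; exact: measurable_funM.
      by apply: measurable_funM => //; exact/measurable_EFinP.
    - move=> w _; rewrite lee_fin.
      have e1 := expR_ge1Dx (a * S 1 w).
      have e2 := ler_wpM2l (ltW a0) (expR_ge1Dx (- S 1 w)).
      by move: e1 e2; move: (expR _) (expR _) => x y; nra.
  under eq_integral do rewrite EFinD.
  rewrite ge0_integralD//.
  - rewrite leeD//; under eq_integral do rewrite EFinM.
    by rewrite ge0_integralZl_EFin ?(ltW a0)// h2.
  - apply/measurable_EFinP; apply: measurableT_comp => //.
    exact: measurable_funM.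
  - by move=> w _; rewrite lee_fin mulr_ge0 ?expR_ge0 ?(ltW a0).
  - apply/measurable_EFinP; apply: measurable_funM => //.
    exact/measurable_EFinP.
rewrite -EFinD lee_fin lerD2l ler_pMr//.
by rewrite -[leLHS]expR0 ler_expR oppr_ge0 leNgt phi1.
Qed.
End subordination.

(** * Fractional moments of the subordinated process for large times *)

Theorem theorem4p4 (d : measure_display) (T : measurableType d) (R : realType)
    (P : probability T R) (Y S : R -> {RV P >-> R})
    (psi : R -> R) (dcoef : nat -> R) (m : nat) (alpha eps p : R)
    (hY : levy_process Y)
    (hpsi : laplace_exponent Y psi)
    (hseries : \forall eta \near 0^'+,
       \sum_(1 <= k < n) dcoef k * eta ^+ k @[n --> \oo] --> psi eta)
    (hm : (1 <= m)%N) (hdm : dcoef m != 0)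
    (hmin : forall k : nat, (1 <= k < m)%N -> dcoef k = 0)
    (halpha : 0 < alpha <= 1) (heps : 0 < eps)
    (hS : InG_subordinator alpha eps S)
    (hindep : indep_processes Y S)
    (hQ : forall t : R, 0 <= t -> {ae P, forall w, 0 <= subordinated Y S t w})
    (hp : 0 < p < 1) :
  let Q := subordinated Y S in
  let xi := dcoef m in
  let c0 := xi `^ (p / m%:R) / alpha in
  (forall t : R, 0 <= t -> measurable_fun [set: T] (fun w => Q t w `^ p)) /\
  (p < alpha ->
     (forall t : R, 0 <= t -> ('E_P[fun w => (Q t w `^ p)%R] < +oo)%E) /\
     asymp_equiv
       (fun t => fine 'E_P[fun w => (Q t w `^ p)%R]%E)
       (fun t => alpha * c0 * t `^ (p / (m%:R * alpha))
                 * Gamma (1 - p / (m%:R * alpha)) / Gamma (1 - p))).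

Proof.
move=> Q xi c0.
have [a0 _] := andP halpha; have [p0 p1] := andP hp.
have [hSub hLap] := hS.
have mQ t : 0 <= t -> measurable_fun setT (Q t).
  exact: measurable_subordinated.
split=> [t t0|pa].
  exact: (measurableT_comp (measurable_powR p) (mQ _ t0)).
pose phi x := alpha / eps `^ alpha * lower_gamma alpha (x * eps).
pose F u := phi (psi u).
pose b := m%:R * alpha.
have m0 : (0 : R) < m%:R by rewrite ltr0n.
have b0 : 0 < b by rewrite mulr_gt0.
have pb : p < b by rewrite (lt_le_trans pa)// ler_peMl ?(ltW a0)// ler1n.
have phi_bounds x (x0 : 0 <= x) := InG_exponent_bounds a0 heps x0.
have phi_ge0 x : 0 <= x -> 0 <= phi x.
  move=> x0; have /andP[+ _] := phi_bounds x x0; apply: le_trans.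
  by rewrite mulr_ge0 ?expR_ge0 ?powR_ge0.
have phi0 : phi 0 = 0.
  by rewrite /phi mul0r /lower_gamma set_itvoo0 Rintegral_set0 mulr0.
have phi1 : 0 < phi 1.
  have /andP[+ _] := phi_bounds 1 ler01; apply: lt_le_trans.
  by rewrite mulr_gt0 ?expR_gt0 ?powR_gt0.
have psi_ge0 u : 0 < u -> 0 <= psi u.
  exact: (laplace_exponent_ge0 hY hSub hindep hQ hpsi hLap phi1).
have psi_cvg := power_series_first_term hm hmin hseries.
(* [xi] is non-zero and is the limit of the non-negative ratios [psi x / x ^+ m]. *)
have xi0 : 0 < xi.
  rewrite lt_neqAle eq_sym hdm/=; apply: (cvgr_to_ge psi_cvg); near=> x.
  by rewrite divr_ge0 ?exprn_ge0 ?psi_ge0.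
have F_cvg : F u / u `^ b @[u --> 0^'+] --> xi `^ alpha.
  exact: InG_composition_asymptotics hm a0 heps xi0 psi_ge0 psi_cvg.
have k0 : 0 < xi `^ alpha by rewrite powR_gt0.
have F_ge0 u : 0 < u -> 0 <= F u by move=> u0; rewrite phi_ge0 ?psi_ge0.
have lapQ t u : 0 <= t -> 0 < u ->
    (\int[P]_w (expR (- (u * Q t w)))%:E = (expR (- (t * F u)))%:E)%E.
  move=> t0 u0; rewrite (laplace_subordinated hY hSub hindep hpsi t0 u0).
  (* A zero of [psi] is outside the reach of [hLap]; there both sides equal [1], as [phi 0 = 0]. *)
  have := psi_ge0 u u0; rewrite le_eqVlt => /predU1P[psi0|psi0].
    rewrite /F -psi0 phi0 mulr0 oppr0 expR0.
    under eq_integral do rewrite mulr0 oppr0 expR0.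
    by rewrite integral_cst//= mul1e probability_setT.
  have := hLap t (psi u) t0 psi0; rewrite unlock => <-.
  by apply: eq_integral => w _; rewrite mulrC.
have mF : measurable_fun (`]0, +oo[%classic : set R) F.
  have lap1 u : 0 < u ->
      (\int[P]_w (expR (- (u * Q 1 w)))%:E = (expR (- F u))%:E)%E.
    by move=> u0; rewrite lapQ// mul1r.
  exact (@measurable_laplace_exponent _ _ _ P (Q 1) (mQ 1 ler01)
    (hQ 1 ler01) F lap1).
pose K := p^-1 * Gamma (1 - p).
have K0 : 0 < K.
  by rewrite mulr_gt0 ?invr_gt0// Gamma_gt0// subr_gt0 p1/= ltrBlDr ltrDl.
pose M t := (\int[P]_w (Q t w `^ p)%:E)%E.
have ME t : ('E_P[fun w => (Q t w `^ p)%R] = M t)%E by rewrite unlock.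
have M_ge0 t : (0 <= M t)%E.
  by apply: integral_ge0 => w _; rewrite lee_fin powR_ge0.
have M_lty t : 0 <= t -> (M t < +oo)%E.
  (* The product of the moment with [K > 0] is a finite integral, which excludes an infinite
     moment. *)
  move=> t0; have := fractional_moment_laplace (mQ t t0) (hQ t t0)
    (fun u => @lapQ t u t0) hp.
  have := fractional_integral_lty F_ge0 mF F_cvg k0 p0 pb t0 => /[swap] <-.
  rewrite -/K -/(M t); have := M_ge0 t; case: (M t) => [r _ _| _|//].
    exact: ltry.
  by rewrite gt0_mulye ?lte_fin.
split=> [t t0|]; first by rewrite ME M_lty.
have scaled t : 0 < t ->
  (t `^ (- b^-1)) `^ p * fine (M t) * K =
  fine (\int[lebesgue_measure]_(u in `]0%R, +oo[)
    (u `^ (- p - 1) * (1 - expR (- (t * F (t `^ (- b^-1) * u)))))%:E)%E.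
  move=> t0; set l := t `^ (- b^-1).
  have l0 : 0 < l by rewrite powR_gt0.
  (* The integral on the right is the transform formula for [l * Q t], whose exponent at [u] is that
     of [Q t] at [l * u]; no change of variables is made in the integral. *)
  rewrite -(@fractional_moment_laplace _ _ _ P (fun w => l * Q t w)
    _ _ _ _ _ hp).
  - rewrite integral_powRZ ?(ltW l0)//;
      [|exact: mQ t (ltW t0)|exact: hQ t (ltW t0)].
    by rewrite -/K -/(M t) -(@fineK _ (M t)) ?ge0_fin_numE ?M_lty ?(ltW t0).
  - by apply: measurable_funM => //; exact: mQ t (ltW t0).
  - by apply: filterS (hQ t (ltW t0)) => w Qw; rewrite mulr_ge0// ltW.
  - move=> u u0; transitivity (\int[P]_w (expR (- (l * u * Q t w)))%:E)%E.
      by apply: eq_integral => w _; rewrite mulrA [u * l]mulrC.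
    exact: lapQ (ltW t0) (mulr_gt0 l0 u0).
have main := scaled_fractional_integral_cvg F_ge0 mF F_cvg k0 p0 pb.
pose L := p^-1 * (xi `^ alpha) `^ (p / b) * Gamma (1 - p / b).
have Gb0 : 0 < Gamma (1 - p / b).
  apply: Gamma_gt0.
  by rewrite subr_gt0 ltr_pdivrMr// mul1r pb/= ltrBlDr ltrDl divr_gt0.
have L0 : 0 < L by rewrite !mulr_gt0 ?invr_gt0// powR_gt0.
have LE : L = p^-1 * xi `^ (p / m%:R) * Gamma (1 - p / b).
  rewrite /L -powRrM; congr (_ * xi `^ _ * _); rewrite /b.
  by field; rewrite !gt_eqF.
(* The moment is [t^(p/b) / K] times the rescaled integral, and the claimed equivalent is
   [t^(p/b) / K] times [L], since [alpha * c0] is [xi^(p/m)]; their quotient is therefore the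
   rescaled integral over its own limit. *)
have ratio := cvgM main (cvg_cst L^-1).
rewrite -/L divff ?gt_eqF// in ratio.
apply: (cvg_trans _ (ratio _ _)); apply: near_eq_cvg; near=> t.
have t0 : 0 < t by [].
rewrite [LHS]/= ME -scaled// LE -/b -powRrM mulNr powRN [b^-1 * p]mulrC.
rewrite /c0 /K -/xi.
have tb0 : 0 < t `^ (p / b) by rewrite powR_gt0.
have xp0 : 0 < xi `^ (p / m%:R) by rewrite powR_gt0.
have Gp0 : 0 < Gamma (1 - p).
  by rewrite Gamma_gt0// subr_gt0 p1/= ltrBlDr ltrDl.
by field; rewrite !gt_eqF.
Unshelve. all: by end_near. Qed.
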